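(* Let $\beta\in\mathcal{BD}_g([0,T];\mathbb{F})$ be $g$-regressive, i.e. $1+\beta(t)\Delta g(t)\neq0$ for all $t\in[0,T]\cap D_g$, and consider the problem $$w'_g(t)-\beta(t)w(t)=0\ \text{ for } g\text{-a.e. } t\in[0,T),\qquad w(0)=1. \qquad (P)$$ Given $v\in W^{1,1}_g([0,T];\mathbb{F})\cap\mathcal{BC}^1_g([0,T];\mathbb{F})$ the solution of $(P)$, a function $h\in\mathcal{BD}^1_g([0,T];\mathbb{F})$ with $h(0)=1$ belongs to $\ker(\partial_g)$ if and only if $\widetilde v=h\,v\in\mathcal{BD}^1_g([0,T];\mathbb{F})$ is a solution of $(P)$ and satisfies $\widetilde v'_g(t)-\beta(t)\widetilde v(t)=0$ for all $t\in[0,T]\setminus C_g$.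
   Context: Let $T>0$, $\mathbb{F}$ be $\mathbb{R}$ or $\mathbb{C}$, and let $g:\mathbb{R}\to\mathbb{R}$ be non-decreasing and left-continuous (a ''derivator''). Put $\Delta g(t)=g(t^+)-g(t)$, $D_g=\{t\in\mathbb{R}:\Delta g(t)>0\}$, and $C_g=\{t\in\mathbb{R}: g \text{ is constant on } (t-\varepsilon,t+\varepsilon)\text{ for some }\varepsilon>0\}$. The set $C_g$ is open; write $C_g=\bigcup_n (a_n,b_n)$ with $(a_n,b_n)$ its (pairwise disjoint) connected components. Put $N_g^-=\{a_n\}_n\setminus D_g$, $N_g^+=\{b_n\}_n\setminus D_g$, $N_g=N_g^-\cup N_g^+$. Standing assumption: $0\notin N_g^-$ and $T\notin N_g^+\cup D_g\cup C_g$. $g$-derivative: for $f:[0,T]\to\mathbb{F}$ and $t\in[0,T]$, $f'_g(t)=\lim_{s\to t}\frac{f(s)-f(t)}{g(s)-g(t)}$ if $t\notin D_g\cup C_g$; $f'_g(t)=\lim_{s\to t^+}\frac{f(s)-f(t)}{g(s)-g(t)}$ if $t\in D_g$; $f'_g(t)=\lim_{s\to b_n^+}\frac{f(s)-f(b_n)}{g(s)-g(b_n)}$ if $t\in(a_n,b_n)\subset C_g$; provided the limit exists. Limits are taken over those $s\in[0,T]$ for which the denominator is nonzero. $f$ is $g$-continuous at $t\in[0,T]$ if for every $\varepsilon>0$ there is $\delta>0$ with $|f(t)-f(s)|<\varepsilon$ for all $s\in[0,T]$ with $|g(t)-g(s)|<\delta$. It is left (resp. right) $g$-continuous at $t$ if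 for every $\varepsilon>0$ there is $\delta>0$ such that $|f(s)-f(t)|<\varepsilon$ for all $s\in[0,T]$ with $s<t$ and $g(t)-g(s)<\delta$ (resp. $s>t$ and $g(s)-g(t)<\delta$). $\mathcal{BD}_g([0,T];\mathbb{F})$ is the set of bounded $f:[0,T]\to\mathbb{F}$ that are $g$-continuous at every point of $[0,T]\setminus(C_g\cup N_g\cup D_g)$, left $g$-continuous on $N_g^-\cap[0,T]$ and right $g$-continuous on $N_g^+\cap[0,T]$. $\mathcal{BD}^1_g([0,T];\mathbb{F})$ is the set of $f\in\mathcal{BD}_g([0,T];\mathbb{F})$ such that $f'_g(t)$ exists for all $t\in[0,T]$ and $f'_g\in\mathcal{BD}_g([0,T];\mathbb{F})$. $\mathcal{BC}^1_g([0,T];\mathbb{F})$ is the set of bounded $g$-continuous $f:[0,T]\to\mathbb{F}$ that are $g$-differentiable at every point of $[0,T]$ with $f'_g$ bounded and $g$-continuous on $[0,T]$. $\ker(\partial_g)=\{h\in\mathcal{BD}^1_g([0,T];\mathbb{F}): h'_g(t)=0\ \forall t\in[0,T]\}$. $\mu_g$ is the Lebesgue–Stieltjes measure with $\mu_g([c,d))=g(d)-g(c)$; ''$g$-a.e.'' means $\mu_g$-a.e. $W^{1,1}_g([0,T];\mathbb{F})$ is the set of $g$-absolutely continuous functions $F:[0,T]\to\mathbb{F}$: for every $\varepsilon>0$ there is $\delta>0$ such that for every finite family of pairwise disjoint open subintervals $(c_j,d_j)$ of $[0,T]$, $\sum_j(g(d_j)-g(c_j))<\delta$ implies $\sum_j|F(d_j)-F(c_j)|<\varepsilon$.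 The problem $(P)$ has a unique solution in $W^{1,1}_g([0,T];\mathbb{F})$. *)

(* Defs.v *)
From HB Require Import structures.
From mathcomp Require Export all_boot all_order all_algebra.
From mathcomp Require Export complex.
From mathcomp Require Export all_classical all_reals all_analysis.
From mathcomp Require Import measurable_realfun.

Set Implicit Arguments.
Unset Strict Implicit.
Unset Printing Implicit Defensive.

Export Order.TTheory GRing.Theory Num.Theory.
Export numFieldNormedType.Exports.

Local Open Scope classical_set_scope.
Local Open Scope ring_scope.

Variant scalar_kind := RealScalars | ComplexScalars.

Definition scalars (R : realType) (k : scalar_kind) : numFieldType :=
  match k with RealScalars => R | ComplexScalars => R[i] end.

Definition of_real (R : realType) (k : scalar_kind) : R -> scalars R k :=
  match k return R -> scalars R k with
  | RealScalars => fun x => x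
  | ComplexScalars => real_complex R
  end.
Arguments of_real {R} k.

Record derivator (R : realType) := Derivator {
  derivator_fun :> R -> R;
  derivator_nondecreasing : {homo derivator_fun : x y / x <= y};
  derivator_left_continuous :
    forall t, derivator_fun x @[x --> t^'-] --> derivator_fun t }.

(* The library's Lebesgue-Stieltjes measures come from right-continuous
   functions and satisfy mu ]a, b] = G b - G a. For a left-continuous g, the
   reflection G x = - g (- x) is right-continuous, and the image under x |-> - x
   of its measure gives g d - g c to [c, d[ (see gmeasure_itvco). *)
Definition reflected {R : realType} (g : derivator R) : R -> R :=
  fun x => - g (- x).

Lemma reflected_nondecreasing (R : realType) (g : derivator R) :
  {homo reflected g : x y / x <= y}.
Proof. by move=> x y xy; rewrite lerN2 derivator_nondecreasing// lerN2. Qed.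

Lemma reflected_right_continuous (R : realType) (g : derivator R) :
  right_continuous (reflected g).
Proof.
move=> x; apply: cvgN; apply/cvg_at_rightNP.
have -> : (fun y => g (- y)) \o -%R = g by apply/funext => y /=; rewrite opprK.
exact: derivator_left_continuous.
Qed.

HB.instance Definition _ (R : realType) (g : derivator R) :=
  isCumulative.Build R _ R (reflected g)
    (@reflected_nondecreasing R g) (@reflected_right_continuous R g).

Definition gmeasure {R : realType} (g : derivator R)
    : set (measurableTypeR R) -> \bar R :=
  pushforward (lebesgue_stieltjes_measure (reflected g))
    (-%R : measurableTypeR R -> measurableTypeR R).

Section gmeasure_is_measure.
Context {R : realType}.
Variable g : derivator R.

Let measurable_oppR : measurable_fun setT
  (-%R : measurableTypeR R -> measurableTypeR R).
Proof. exact: oppr_measurable. Qed.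

Let gmeasure0 : gmeasure g set0 = 0%E.
Proof. by rewrite /gmeasure /pushforward preimage_set0 measure0. Qed.

Let gmeasure_ge0 A : (0 <= gmeasure g A)%E.
Proof. exact: measure_ge0. Qed.

Let gmeasure_sigma_additive : semi_sigma_additive (gmeasure g).
Proof.
have mN (A : set (measurableTypeR R)) : measurable A ->
    measurable ((-%R : measurableTypeR R -> measurableTypeR R) @^-1` A).
  by move=> mA; rewrite -[X in measurable X]setTI; exact: measurable_oppR.
move=> F mF tF mUF; rewrite /gmeasure /pushforward preimage_bigcup.
apply: measure_semi_sigma_additive.
- by move=> n; exact: mN.
- apply/trivIsetP => /= i j _ _ ij; rewrite -preimage_setI.
  by move/trivIsetP : tF => /(_ _ _ _ _ ij) ->//; rewrite preimage_set0.
- by rewrite -preimage_bigcup; exact: mN.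
Qed.

HB.instance Definition _ := isMeasure.Build _ _ _ (gmeasure g)
  gmeasure0 gmeasure_ge0 gmeasure_sigma_additive.

End gmeasure_is_measure.

Lemma gmeasure_itvco (R : realType) (g : derivator R) (c d : R) :
  c <= d -> gmeasure g `[c, d[ = (g d - g c)%:E.
Proof.
move=> cd; rewrite /gmeasure /pushforward.
have -> : -%R @^-1` `[c, d[ = `]- d, - c]%classic :> set R.
  by apply/seteqP; split=> x /=; rewrite !in_itv/= lerNr ltrNl andbC.
rewrite /lebesgue_stieltjes_measure /measure_extension measurable_mu_extE/=.
  by rewrite wlength_itv_bnd ?lerN2// /reflected !opprK addrC.
exact: is_ocitv.
Qed.

Section derivators.
Context {R : realType}.
Variable g : derivator R.

Definition jump (t : R) : R := lim (g x @[x --> t^'+]) - g t.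

Definition Dg : set R := [set t | 0 < jump t].

Definition Cg : set R :=
  [set t | exists2 e : R, 0 < e &
     forall x y, x \in `]t - e, t + e[ -> y \in `]t - e, t + e[ -> g x = g y].

(* For t in Cg, the component ]a_n, b_n[ of Cg that contains t. It may be
   unbounded, in which case it has no real endpoint on that side. *)
Definition Cg_component (t : R) : set R := connected_component Cg t.

Definition Ng_minus : set R :=
  [set a | exists t, [/\ Cg t, has_lbound (Cg_component t) &
                         a = inf (Cg_component t)]] `\` Dg.

Definition Ng_plus : set R :=
  [set b | exists t, [/\ Cg t, has_ubound (Cg_component t) &
                         b = sup (Cg_component t)]] `\` Dg.

Definition Ng : set R := Ng_minus `|` Ng_plus.

End derivators.

(* Functions on [0, T] are represented by total functions on R of which only
   the values on [0, T] are ever used. *)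
Section gcalculus.
Context {R : realType} {k : scalar_kind}.
Variables (g : derivator R) (T : R).
Implicit Types f : R -> scalars R k.

(* t itself, or b_n when t lies in the component ]a_n, b_n[ of Cg *)
Definition gbase (t : R) : R :=
  if t \in Cg g then sup (Cg_component g t) else t.

Definition gquotient f (t s : R) : scalars R k :=
  (f s - f (gbase t)) / of_real k (g s - g (gbase t)).

Definition gnbhs (t : R) : set_system R :=
  within [set s | s \in `[0, T] /\ g s != g (gbase t)]
    (if t \in Cg g `|` Dg g then (gbase t)^'+ else nbhs t).

Definition gdifferentiable f (t : R) : Prop := cvg (gquotient f t @ gnbhs t).

Definition gderive f (t : R) : scalars R k := lim (gquotient f t @ gnbhs t).

(* Over the complex scalars, [0 < e] means that e is a positive real. *)
Definition gcontinuous_at f (t : R) : Prop :=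
  forall e : scalars R k, 0 < e -> exists2 delta : R, 0 < delta &
    forall s, s \in `[0, T] -> `|g t - g s| < delta -> `|f t - f s| < e.

Definition left_gcontinuous_at f (t : R) : Prop :=
  forall e : scalars R k, 0 < e -> exists2 delta : R, 0 < delta &
    forall s, s \in `[0, T] -> s < t -> g t - g s < delta -> `|f s - f t| < e.

Definition right_gcontinuous_at f (t : R) : Prop :=
  forall e : scalars R k, 0 < e -> exists2 delta : R, 0 < delta &
    forall s, s \in `[0, T] -> t < s -> g s - g t < delta -> `|f s - f t| < e.

Definition BD f : Prop :=
  [/\ [bounded f t | t in `[0, T]],
      forall t, t \in `[0, T] -> ~ (Cg g `|` Ng g `|` Dg g) t ->
        gcontinuous_at f t,
      forall t, t \in `[0, T] -> Ng_minus g t -> left_gcontinuous_at f t &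
      forall t, t \in `[0, T] -> Ng_plus g t -> right_gcontinuous_at f t].

Definition BD1 f : Prop :=
  [/\ BD f, forall t, t \in `[0, T] -> gdifferentiable f t & BD (gderive f)].

Definition BC f : Prop :=
  [bounded f t | t in `[0, T]] /\
  forall t, t \in `[0, T] -> gcontinuous_at f t.

Definition BC1 f : Prop :=
  [/\ BC f, forall t, t \in `[0, T] -> gdifferentiable f t & BC (gderive f)].

Definition ker_gderive f : Prop :=
  BD1 f /\ forall t, t \in `[0, T] -> gderive f t = 0.

Definition W11 f : Prop :=
  forall e : scalars R k, 0 < e -> exists2 delta : R, 0 < delta &
    forall (n : nat) (c d : 'I_n -> R),
      (forall j, [/\ 0 <= c j, c j < d j & d j <= T]) ->
      trivIset setT (fun j => `]c j, d j[%classic) ->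
      \sum_(j < n) (g (d j) - g (c j)) < delta ->
      \sum_(j < n) `|f (d j) - f (c j)| < e.

Definition gregressive (beta : R -> scalars R k) : Prop :=
  forall t, t \in `[0, T] -> Dg g t -> 1 + beta t * of_real k (jump g t) != 0.

Definition solves_P (beta w : R -> scalars R k) : Prop :=
  {ae gmeasure g, forall t : R, t \in `[0, T[ ->
     gdifferentiable w t /\ gderive w t - beta t * w t = 0} /\
  w 0 = 1.

End gcalculus.

(* Main.v *)
From HB Require Import structures.
Require Import Defs.
From mathcomp Require Import ring lra.

Set Implicit Arguments.
Unset Strict Implicit.
Unset Printing Implicit Defensive.

Local Open Scope classical_set_scope.
Local Open Scope ring_scope.

(** The proof compares the equations for [v] and [h v] through the product rule
      [(h v)' = h v' + h' (v + v' jump)],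
    proved in [gderiveM] (at a point of a component of [Cg], everything on the
    right is evaluated at the right endpoint of the component).

    First, the equation [v' = beta v], known almost everywhere, holds at every
    point of [0, T] outside [Cg] ([BD_ae_eq]): jumps of [g] are atoms, and any other
    point is a limit of points where the equation holds, along a side on which both
    members are g-continuous.

    If [h' = 0], the product rule gives [(h v)' = h v'], hence the equation for
    [h v] outside [Cg]; this is enough almost everywhere because [Cg] is negligible
    ([negligible_Cg]). That [(h v)'] is again in [BD] holds because composing with
    the map to the right endpoints of the components preserves [BD] ([BD_gbase]).

    Conversely, if [h v] satisfies the equation outside [Cg], subtracting [h] times
    the equation for [v] leaves [h' v (1 + beta jump) = 0]. The last factor is
    nonzero because [beta] is regressive, and [v] has no zero ([solution_neq0]). The
    reason for the latter is uniqueness backwards in time. Take the infimum [b] of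
    the zeros; it is a zero, because the right limit of [v] at [b] is
    [v b (1 + beta jump)] ([zeros_inf]). By a mean value inequality ([gmean_value]),
    [v] then vanishes on an interval ending at [b] ([zero_spreads_left]), which
    contradicts the choice of [b], or [v 0 = 1] if [b = 0]. Finally, the
    derivative of [h] on a component of [Cg] is its derivative at the right
    endpoint, which is outside [Cg]. *)

(** * Structure of a derivator *)

Section derivator_structure.
Context {R : realType}.
Variable g : derivator R.

Lemma derivator_le x y : x <= y -> g x <= g y.
Proof. exact: derivator_nondecreasing. Qed.

Lemma derivator_cvg_right t : g x @[x --> t^'+] --> g t + jump g t.
Proof.
rewrite /jump addrC subrK.
apply: nondecreasing_at_right_is_cvgr.
  by apply: nearW => x y z _ _; exact: derivator_le.
apply: nearW => x; exists (g t) => z [y /=].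
by rewrite in_itv/= => /andP[ty _] <-; exact/derivator_le/ltW.
Qed.

Lemma derivator_left_close t (e : R) : 0 < e ->
  exists2 c, c < t & g t - g c < e.
Proof.
move=> e0; have /cvgrPdist_lt /(_ _ e0) gt := @derivator_left_continuous R g t.
suff : \forall c \near t^'-, c < t /\ g t - g c < e.
  by move=> /(@filter_ex _ _ (at_left_proper_filter t))[c [ct gc]]; exists c.
near=> c; split; first by near: c; exact: nbhs_left_lt.
by apply: le_lt_trans (ler_norm _) _; near: c.
Unshelve. all: by end_near. Qed.

Lemma derivator_right_close t (e : R) : ~ Dg g t -> 0 < e ->
  exists2 d, t < d & g d - g t < e.
Proof.
move=> /negP; rewrite -leNgt => jt e0.
have /cvgrPdist_lt /(_ _ e0) gt := @derivator_cvg_right t.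
suff : \forall d \near t^'+, t < d /\ g d - g t < e.
  by move=> /(@filter_ex _ _ (at_right_proper_filter t))[d [td gd]]; exists d.
near=> d; split; first by near: d; exact: nbhs_right_gt.
have : `|g t + jump g t - g d| < e by near: d.
rewrite distrC; move/(le_lt_trans (ler_norm _)); apply: le_lt_trans.
by rewrite lerB// gerDl.
Unshelve. all: by end_near. Qed.

Lemma derivator_ge_jump t y : t < y -> g t + jump g t <= g y.
Proof.
move=> ty; have gt := @derivator_cvg_right t.
rewrite -(cvg_lim _ gt)//; apply: limr_le; first by apply/cvg_ex; eexists; exact: gt.
near=> x; apply: derivator_le; apply: ltW; near: x; exact: nbhs_right_lt.
Unshelve. all: by end_near. Qed.

Lemma jump_ge0 t : 0 <= jump g t.
Proof.
rewrite /jump subr_ge0; apply: limr_ge.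
  by apply/cvg_ex; eexists; exact: derivator_cvg_right.
near=> x; apply: derivator_le; apply: ltW; near: x; exact: nbhs_right_gt.
Unshelve. all: by end_near. Qed.

Lemma jump_eq0 t : ~ Dg g t -> jump g t = 0.
Proof. by move=> /negP; rewrite -leNgt => jt; apply/eqP; rewrite eq_le jt jump_ge0. Qed.

Lemma not_Cg_lt t x y : ~ Cg g t -> x < t -> t < y -> g x < g y.
Proof.
move=> tC xt ty; rewrite ltNge; apply/negP => gyx; apply: tC.
have gc z : x <= z -> z <= y -> g z = g x.
  move=> xz zy; apply/eqP; rewrite eq_le (derivator_le xz) andbT.
  exact: le_trans (derivator_le zy) gyx.
exists (Num.min (t - x) (y - t)); first by rewrite lt_min !subr_gt0 xt ty.
move=> u w; rewrite !in_itv/=.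
have m1 : Num.min (t - x) (y - t) <= t - x by rewrite ge_min lexx.
have m2 : Num.min (t - x) (y - t) <= y - t by rewrite ge_min lexx orbT.
by move=> /andP[u1 u2] /andP[w1 w2]; rewrite !gc//; lra.
Qed.

Lemma open_Cg_ball t : Cg g t ->
  exists2 e : R, 0 < e & forall x, t - e < x -> x < t + e -> Cg g x.
Proof.
case=> e e0 ge; exists e => // x x1 x2.
exists (Num.min (x - (t - e)) (t + e - x)).
  by rewrite lt_min !subr_gt0 x1 x2.
have m1 : Num.min (x - (t - e)) (t + e - x) <= x - (t - e) by rewrite ge_min lexx.
have m2 : Num.min (x - (t - e)) (t + e - x) <= t + e - x by rewrite ge_min lexx orbT.
move=> u w; rewrite !in_itv/= => /andP[u1 u2] /andP[w1 w2].
by apply: ge; rewrite in_itv/=; lra.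
Qed.

(** A point of [Cg] lies in an interval with rational endpoints on which [g] is
    constant. There are countably many of these, and each is null. *)
Lemma negligible_Cg : (gmeasure g).-negligible (Cg g : set (measurableTypeR R)).
Proof.
pose F (q : rat * rat) : set (measurableTypeR R) :=
  if (q.1 <= q.2) && (g (ratr q.1) == g (ratr q.2))
  then `[ratr q.1, ratr q.2[%classic else set0.
have F0 q : (gmeasure g).-negligible (F q).
  rewrite /F; case: ifPn => [/andP[q12 /eqP gq]|_]; last exact: negligible_set0.
  exists `[ratr q.1, ratr q.2[%classic; split => //.
  rewrite gmeasure_itvco ?ler_rat//.
  by rewrite gq subrr.
have : (gmeasure g).-negligible
    (\bigcup_i (if unpickle i is Some q then F q else set0)).
  by apply: negligible_bigcup => i; case: unpickle => [q|]//; exact: negligible_set0.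
apply: negligibleS.
move=> t [e e0 ge].
have /rat_in_itvoo[p] : t - e < t by rewrite gtrBl.
rewrite in_itv/= => /andP[p1 p2].
have /rat_in_itvoo[q] : t < t + e by rewrite ltrDl.
rewrite in_itv/= => /andP[q1 q2].
have [i iE] : exists i, unpickle i = Some (p, q).
  by exists (pickle (p, q)); rewrite pickleK.
exists i; first exact: I.
rewrite iE /F ifT; first by rewrite /= in_itv/= (ltW p2) q1.
have pq : (ratr p : R) < ratr q by exact: lt_trans q1.
rewrite /= -(ler_rat R) (ltW pq)/=; apply/eqP; apply: ge; rewrite in_itv/=; lra.
Qed.

(** Local constancy becomes constancy without a compactness argument: an
    interval contained in [Cg] is negligible, and its measure is the increment
    of [g]. *)
Lemma Cg_flat x y : x <= y -> (forall z, x <= z -> z < y -> Cg g z) -> g x = g y.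
Proof.
move=> xy xyC; apply/esym/eqP; rewrite -subr_eq0.
have [A [mA A0 CA]] := negligible_Cg.
have : (gmeasure g `[x, y[ <= gmeasure g A)%E.
  apply: le_measure; rewrite ?inE//= => z /=.
  by rewrite in_itv/= => /andP[xz zy]; apply/CA/xyC.
rewrite A0 gmeasure_itvco// lee_fin => gyx.
by rewrite eq_le gyx subr_ge0 derivator_le.
Qed.

Lemma Cg_component_sub t x : Cg_component g t x -> Cg g x.
Proof. by rewrite /Cg_component => /connected_component_sub. Qed.

Lemma Cg_component_self t x : Cg_component g t x -> Cg_component g t t.
Proof.
rewrite /Cg_component => -[A [At AC cA] Ax]; exact: connected_component_refl (AC _ At).
Qed.

Lemma Cg_component_itv t x : Cg_component g t x ->
  forall z, (t <= z <= x) || (x <= z <= t) -> Cg_component g t z.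
Proof.
move=> tx z; have tt : Cg_component g t t.
  exact: Cg_component_self tx.
have /connected_intervalP Ci : connected (Cg_component g t).
  exact: component_connected.
by move=> /orP[]; apply: Ci.
Qed.

Lemma Cg_component_max t x :
  (forall z, (t <= z <= x) || (x <= z <= t) -> Cg g z) -> Cg_component g t x.
Proof.
move=> tx.
apply: (@connected_component_max _ _ [set z | (t <= z <= x) || (x <= z <= t)]).
- by rewrite /= lexx; case: (leP t x) => //= /ltW ->.
- by move=> z /tx.
- apply/connected_intervalP => u w /= uI wI z; lra.
- by rewrite /= lexx; case: (leP t x) => //= /ltW ->.
Qed.

(** The supremum is outside [Cg] because [Cg] is open: otherwise the component
    would extend past it. *)
Lemma Cg_component_sup t : Cg g t -> has_ubound (Cg_component g t) ->
  let b := sup (Cg_component g t) in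
  [/\ t < b, ~ Cg g b & forall z, t <= z -> z < b -> Cg g z].
Proof.
move=> tC ub b.
have tt : Cg_component g t t by exact: connected_component_refl.
have hs : has_sup (Cg_component g t) by split => //; exists t.
have bC z : t <= z -> z < b -> Cg g z.
  move=> tz zb; have [x tx zx] := sup_adherent (eps := b - z) ltac:(by rewrite subr_gt0) hs.
  apply: (@Cg_component_sub t); apply: (Cg_component_itv tx).
  by rewrite tz/= (ltW _)//; move: zx; rewrite opprB addrC subrK.
have beyond z : t <= z -> Cg g z -> z <= b -> exists2 w, z < w & Cg_component g t w.
  move=> tz zC zb; have [e e0 ze] := open_Cg_ball zC.
  exists (z + e / 2); first lra.
  apply: Cg_component_max => w tw; case: (ltP w z) => wz.
    apply: bC; lra.
  apply: ze; lra.
have tb : t < b.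
  have [|w tw wC] := beyond t (lexx _) tC; first exact: ub_le_sup.
  by apply: lt_le_trans tw _; exact: ub_le_sup.
split => // Cb; have [w tw wC] := beyond b (ltW tb) Cb (lexx _).
by move: tw; apply/negP; rewrite -leNgt; exact: ub_le_sup.
Qed.

Lemma Cg_component_inf t : Cg g t -> has_lbound (Cg_component g t) ->
  let a := inf (Cg_component g t) in
  [/\ a < t, ~ Cg g a & forall z, a < z -> z <= t -> Cg g z].
Proof.
move=> tC lb a.
have tt : Cg_component g t t by exact: connected_component_refl.
have hs : has_inf (Cg_component g t) by split => //; exists t.
have aC z : a < z -> z <= t -> Cg g z.
  move=> az zt; have [x tx zx] := inf_adherent (eps := z - a) ltac:(by rewrite subr_gt0) hs.
  apply: (@Cg_component_sub t); apply: (Cg_component_itv tx).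
  by apply/orP; right; rewrite zt andbT ltW//; move: zx; rewrite addrC subrK.
have beyond z : z <= t -> Cg g z -> a <= z -> exists2 w, w < z & Cg_component g t w.
  move=> zt zC az; have [e e0 ze] := open_Cg_ball zC.
  exists (z - e / 2); first lra.
  apply: Cg_component_max => w tw; case: (ltP z w) => wz.
    apply: aC; lra.
  apply: ze; lra.
have inf_lt : a < t.
  have [|w wt wC] := beyond t (lexx _) tC; first exact: ge_inf.
  by apply: le_lt_trans wt; exact: ge_inf.
split => // Ca; have [w wa wC] := beyond a (ltW inf_lt) Ca (lexx _).
by move: wa; apply/negP; rewrite -leNgt; exact: ge_inf.
Qed.

Lemma Ng_minus_notin_Cg t : Ng_minus g t -> ~ Cg g t.
Proof. by case=> -[u [uC lb ->]] _; have [] := Cg_component_inf uC lb. Qed.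

Lemma Ng_plus_notin_Cg t : Ng_plus g t -> ~ Cg g t.
Proof. by case=> -[u [uC ub ->]] _; have [] := Cg_component_sup uC ub. Qed.

(** Since [t] is not a jump, [g] keeps the value [g t] on the component that
    starts at [t]. If it kept this value on the left as well, [t] would be in
    [Cg]. *)
Lemma Ng_minus_lt t s : Ng_minus g t -> s < t -> g s < g t.
Proof.
move=> tN st; have tC := Ng_minus_notin_Cg tN.
case: tN => -[u [uC lb tE]] tD.
have [tu _ tuC] := Cg_component_inf uC lb; rewrite -tE in tu tuC.
suff <- : g u = g t by exact: not_Cg_lt tC st tu.
have flat z : t < z -> z <= u -> g z = g u.
  move=> tz zu; apply: Cg_flat => // w zw wu; apply: tuC; last exact: ltW.
  exact: lt_le_trans zw.
apply/eqP; rewrite eq_le [X in _ && X]derivator_le ?(ltW tu)// andbT.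
apply/ler_addgt0Pr => e e0; have [d td gd] := derivator_right_close tD e0.
case: (leP d u) => [du|/ltW ud]; first by rewrite -(flat d)//; lra.
by have := derivator_le ud; lra.
Qed.

Lemma flat_itv_Cg x y z : g x = g y -> x < z -> z < y -> Cg g z.
Proof.
by move=> gxy xz zy; apply: contrapT => /not_Cg_lt/(_ xz zy); rewrite gxy ltxx.
Qed.

(** Converse to the description of [Ng_minus]: if [g] stalls on the right of
    [t], then the component of [Cg] through a point of the stall starts at [t]. *)
Lemma flat_right_Ng_minus t y : ~ Cg g t -> t < y -> g t = g y -> Ng_minus g t.
Proof.
move=> tC ty gty; split; last first.
  by move=> tD; have := derivator_ge_jump ty; rewrite -gty; move: tD; rewrite /Dg/=; lra.
have mC : Cg g ((t + y) / 2) by apply: (flat_itv_Cg gty); lra.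
have lb z : Cg_component g ((t + y) / 2) z -> t <= z.
  move=> zC; rewrite leNgt; apply/negP => zt; apply: tC.
  apply: (@Cg_component_sub ((t + y) / 2)).
  by apply: (Cg_component_itv zC); lra.
have hl : has_lbound (Cg_component g ((t + y) / 2)) by exists t.
exists ((t + y) / 2); split => //; apply/eqP; rewrite eq_le; apply/andP; split.
  by apply: lb_le_inf => //; exists ((t + y) / 2); exact: connected_component_refl.
rewrite leNgt; apply/negP => tI.
have [im inC _] := Cg_component_inf mC hl.
by apply: inC; apply: (flat_itv_Cg gty) => //; lra.
Qed.

Lemma flat_left_Ng_plus t x : ~ Cg g t -> ~ Dg g t -> x < t -> g x = g t ->
  Ng_plus g t.
Proof.
move=> tC tD xt gxt; split => //.
have mC : Cg g ((x + t) / 2) by apply: (flat_itv_Cg gxt); lra.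
have ub z : Cg_component g ((x + t) / 2) z -> z <= t.
  move=> zC; rewrite leNgt; apply/negP => zt; apply: tC.
  apply: (@Cg_component_sub ((x + t) / 2)).
  by apply: (Cg_component_itv zC); lra.
have hl : has_ubound (Cg_component g ((x + t) / 2)) by exists t.
exists ((x + t) / 2); split => //; apply/eqP; rewrite eq_le andbC; apply/andP; split.
  by apply: ge_sup => //; exists ((x + t) / 2); exact: connected_component_refl.
rewrite leNgt; apply/negP => tI.
have [im inC _] := Cg_component_sup mC hl.
by apply: inC; apply: (flat_itv_Cg gxt) => //; lra.
Qed.

End derivator_structure.

(** * Real scalars inside the scalar field *)

Section scalars_theory.
Context {R : realType} {k : scalar_kind}.
Local Notation K := (scalars R k).

Lemma of_realB : zmod_morphism (@of_real R k).
Proof. by case: k => x y //=; rewrite rmorphB. Qed.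

Lemma of_realM : monoid_morphism (@of_real R k).
Proof. by case: k; split => //= x y; rewrite rmorphM. Qed.

HB.instance Definition _ := GRing.isZmodMorphism.Build R K (@of_real R k) of_realB.
HB.instance Definition _ := GRing.isMonoidMorphism.Build R K (@of_real R k) of_realM.

Lemma of_real_le (x y : R) : (of_real k x <= of_real k y) = (x <= y).
Proof. by case: k => //; exact: lecR. Qed.

Lemma of_real_lt (x y : R) : (of_real k x < of_real k y) = (x < y).
Proof. by case: k => //; exact: ltcR. Qed.

Lemma of_real_norm (x : R) : `|of_real k x| = of_real k `|x|.
Proof. by case: k => //=; rewrite normc_def /= expr0n addr0 sqrtr_sqr. Qed.

(** Suprema are available in [R] only; this carries norms in either scalar field
    back to [R]. *)
Lemma norm_of_real (x : K) : exists2 r, 0 <= r & `|x| = of_real k r.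
Proof.
have [r rE] : exists r, `|x| = of_real k r.
  move: x; case: k => x /=; first by exists `|x|.
  by rewrite normc_def; eexists.
by exists r => //; rewrite -of_real_le -rE rmorph0.
Qed.

Lemma gt0_of_real (e : K) : 0 < e -> exists2 r, 0 < r & e = of_real k r.
Proof.
move=> e0; have [r _ rE] := norm_of_real e; exists r; last by rewrite -rE gtr0_norm.
by rewrite -of_real_lt -rE rmorph0 gtr0_norm.
Qed.

Lemma cvg_of_real {X : Type} (F : set_system X) {FF : Filter F} (f : X -> R) (l : R) :
  f @ F --> l -> (fun x => of_real k (f x)) @ F --> of_real k l.
Proof.
move=> /cvgrPdist_lt fl; apply/cvgrPdist_lt => e /gt0_of_real[r r0 ->].
near=> x; rewrite -rmorphB of_real_norm of_real_lt; near: x; exact: fl.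
Unshelve. all: by end_near. Qed.

Lemma norm_lt_all_eq0 (x : K) : (forall e, 0 < e -> `|x| < e) -> x = 0.
Proof.
move=> xe; apply/eqP; apply: contraT => x0.
by have := xe _ _; move=> /(_ `|x|); rewrite normr_gt0 x0 ltxx => /(_ isT).
Qed.

End scalars_theory.

(** * The g-derivative and its product rule *)

Section gbase_theory.
Context {R : realType} {k : scalar_kind}.
Variables (g : derivator R) (T : R).
Hypotheses (T_gt0 : 0 < T) (g0 : ~ Ng_minus g 0)
  (gT : ~ (Ng_plus g `|` Dg g `|` Cg g) T).
Local Notation K := (scalars R k).
Implicit Types f w : R -> K.

Lemma T_notin_Cg : ~ Cg g T. Proof. by move=> ?; apply: gT; right. Qed.
Lemma T_notin_Dg : ~ Dg g T. Proof. by move=> ?; apply: gT; left; right. Qed.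
Lemma T_notin_Ng_plus : ~ Ng_plus g T. Proof. by move=> ?; apply: gT; left; left. Qed.

Lemma gbase_id t : ~ Cg g t -> gbase g t = t.
Proof. by rewrite /gbase; case: ifPn => // /set_mem. Qed.

Lemma gbase_spec t : t \in `[0, T] ->
  [/\ t <= gbase g t, gbase g t \in `[0, T], ~ Cg g (gbase g t),
      forall s, t <= s -> s <= gbase g t -> g s = g (gbase g t) &
      forall u, ~ Cg g u -> t <= u -> gbase g t <= u].
Proof.
rewrite in_itv/= => /andP[t0 tT].
have [tC|tC] := pselect (Cg g t); last first.
  rewrite gbase_id// in_itv/= t0 tT; split => // s ts st.
  by congr (g _); apply/eqP; rewrite eq_le st.
have bnd u : ~ Cg g u -> t <= u -> ubound (Cg_component g t) u.
  move=> uC tu x tx; rewrite leNgt; apply/negP => ux; apply: uC.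
  by apply: (@Cg_component_sub _ _ t); apply: (Cg_component_itv tx); rewrite tu ltW.
have ub : has_ubound (Cg_component g t) by exists T; exact: bnd T_notin_Cg tT.
have [tb bC flat] := Cg_component_sup tC ub.
have bu u : ~ Cg g u -> t <= u -> sup (Cg_component g t) <= u.
  move=> uC tu; apply: ge_sup; last exact: bnd.
  by exists t; exact: connected_component_refl.
rewrite /gbase mem_set//; split => //; first exact: ltW.
- by rewrite in_itv/= bu// ?andbT; [lra|exact: T_notin_Cg].
- move=> s ts sb; apply: Cg_flat => // z sz zb; apply: flat => //.
  exact: le_trans sz.
Qed.

Lemma gbase_eq t : t \in `[0, T] -> g (gbase g t) = g t.
Proof. by move=> /gbase_spec[tb _ _ flat _]; rewrite -(flat t). Qed.

Lemma gbase_idem t : t \in `[0, T] -> gbase g (gbase g t) = gbase g t.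
Proof. by move=> /gbase_spec[_ _ bC _ _]; exact: gbase_id. Qed.

(** Outside [Cg], [g] varies strictly on one side of [t], and this can be
    chosen to be a side of [t] inside [0, T] on which functions in [BD] are
    g-continuous when [t] is not a jump. The conditions at the endpoints are
    used here: [~ Ng_minus g 0] leaves the right side of 0, and
    [T] being in neither [Ng_plus g] nor [Dg g] the left side of [T]. *)
Lemma accumulation_cases t : t \in `[0, T] -> ~ Cg g t ->
  [/\ 0 < t, ~ Dg g t, Ng_minus g t \/ ~ Ng g t & forall s, s < t -> g s < g t] \/
  [/\ t < T, Ng_plus g t \/ ~ Ng g t & forall s, t < s -> g t < g s].
Proof.
rewrite in_itv/= => /andP[t0 tT] tC.
have [tN|tN] := pselect (Ng_minus g t).
  left; split; [|by case: tN|by left|by move=> s; exact: Ng_minus_lt].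
  by rewrite lt_neqAle t0 andbT; apply/eqP => tE; apply: g0; rewrite tE.
have strict s : t < s -> g t < g s.
  move=> ts; rewrite lt_neqAle derivator_le ?ltW// andbT; apply/eqP => gts.
  exact/tN/(flat_right_Ng_minus tC ts gts).
have [tET|/eqP tNT] := eqVneq t T; last first.
  right; split=> //; first by rewrite lt_neqAle tT andbT; apply/eqP.
  have [tP|tP] := pselect (Ng_plus g t); [by left|by right; case].
move: tET tN strict tC {tT} => -> tN strict tC; left.
have TS s : s < T -> g s < g T.
  move=> sT; rewrite lt_neqAle derivator_le ?ltW// andbT; apply/eqP => gsT.
  exact/T_notin_Ng_plus/(flat_left_Ng_plus tC T_notin_Dg sT gsT).
split=> //; first exact: T_notin_Dg.
by right; case => //; exact: T_notin_Ng_plus.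
Qed.

Lemma gnbhs_right t (P : set R) : gnbhs g T t P ->
  \forall s \near (gbase g t)^'+,
    s \in `[0, T] -> g s != g (gbase g t) -> P s.
Proof.
rewrite /gnbhs; case: ifPn => tCD tP.
  have {}tP : \forall s \near (gbase g t)^'+,
      s \in `[0, T] /\ g s != g (gbase g t) -> P s by exact: tP.
  by near=> s => sT gs; suff: s \in `[0, T] /\ g s != g (gbase g t) by near: s.
have tC : ~ Cg g t by move=> tC; move/negP: tCD; apply; apply: mem_set; left.
rewrite gbase_id// in tP *.
have {}tP : \forall s \near t, s \in `[0, T] /\ g s != g t -> P s by exact: tP.
near=> s => sT gs; suff: s \in `[0, T] /\ g s != g t by near: s; exact: cvg_within.
by [].
Unshelve. all: by end_near. Qed.

Lemma gnbhs_left t (P : set R) : ~ Cg g t -> ~ Dg g t -> gnbhs g T t P ->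
  \forall s \near t^'-, s \in `[0, T] -> g s != g t -> P s.
Proof.
move=> tC tD; rewrite /gnbhs gbase_id// ifF; last first.
  by apply/negP => /set_mem[].
move=> tP.
have {}tP : \forall s \near t, s \in `[0, T] /\ g s != g t -> P s by exact: tP.
near=> s => sT gs; suff: s \in `[0, T] /\ g s != g t by near: s; exact: cvg_within.
by [].
Unshelve. all: by end_near. Qed.

Global Instance gnbhs_filter t : Filter (gnbhs g T t).
Proof. by rewrite /gnbhs; case: ifP => _; exact: within_filter. Qed.

Lemma gnbhs_support t : gnbhs g T t [set s | s \in `[0, T] /\ g s != g (gbase g t)].
Proof. by rewrite /gnbhs; case: ifP => _; exact: withinT. Qed.

(** At the right endpoint [b] of a component, a difference quotient only sees
    [s > b], even when [b] is not a jump: the other nearby points have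
    [g s = g b]. *)
Lemma gnbhs_base t : t \in `[0, T] -> gnbhs g T t = gnbhs g T (gbase g t).
Proof.
move=> tT; have [tC|tC] := pselect (Cg g t); last by rewrite gbase_id.
have [tb bT bC flat _] := gbase_spec tT.
have bb := gbase_id bC.
have ltb : t < gbase g t.
  by rewrite lt_neqAle tb andbT; apply/eqP => tE; rewrite -tE in bC.
rewrite {1}/gnbhs ifT; last by apply/mem_set; left.
apply/seteqP; split => P; last first.
  move=> /gnbhs_right; rewrite bb => bP.
  suff : \forall s \near (gbase g t)^'+,
      s \in `[0, T] /\ g s != g (gbase g t) -> P s by [].
  by apply: filterS bP => s sP [sT gs]; exact: sP.
rewrite /gnbhs bb; case: ifPn => // _ /= bP.
have {}bP : \forall s \near gbase g t, gbase g t < s ->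
    s \in `[0, T] /\ g s != g (gbase g t) -> P s by exact: bP.
rewrite /within/=; near=> s => -[sT gs].
have [bs|sb] := ltP (gbase g t) s.
  suff sP : gbase g t < s -> s \in `[0, T] /\ g s != g (gbase g t) -> P s by exact: sP.
  by near: s; exact: bP.
move: gs; rewrite flat ?eqxx//; apply: ltW; near: s; exact: lt_nbhsr.
Unshelve. all: by end_near. Qed.

Lemma gnbhs_ex t (P : set R) : t \in `[0, T] -> gnbhs g T t P ->
  exists s, [/\ s \in `[0, T], g s != g (gbase g t) & P s].
Proof.
move=> tT; rewrite gnbhs_base//; have := gbase_idem tT.
have [_ + + _ _] := gbase_spec tT; move: (gbase g t) => b bT bC bb bP.
have [[b_gt0 bD _ lb]|[ltT _ lb]] := accumulation_cases bT bC.
  suff : \forall s \near b^'-, [/\ s \in `[0, T], g s != g b & P s].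
    by move=> /(@filter_ex _ _ (at_left_proper_filter b)).
  have {}bP := gnbhs_left bC bD bP; near=> s.
  have sb : s < b by near: s; exact: nbhs_left_lt.
  have sT : s \in `[0, T].
    move: bT; rewrite !in_itv/= => /andP[_ bT]; apply/andP; split; last lra.
    by apply: ltW; near: s; exact: nbhs_left_gt.
  have gs : g s != g b by rewrite lt_eqF// lb.
  by split => //; move: sT gs; near: s.
suff : \forall s \near b^'+, [/\ s \in `[0, T], g s != g b & P s].
  by move=> /(@filter_ex _ _ (at_right_proper_filter b)).
have {}bP := gnbhs_right bP; rewrite bb in bP; near=> s.
have sb : b < s by near: s; exact: nbhs_right_gt.
have sT : s \in `[0, T].
  move: bT; rewrite !in_itv/= => /andP[b0 _]; apply/andP; split; first lra.
  by apply: ltW; near: s; exact: nbhs_right_lt.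
have gs : g s != g b by rewrite gt_eqF// lb.
by split => //; move: sT gs; near: s.
Unshelve. all: by end_near. Qed.

Lemma gnbhs_proper t : t \in `[0, T] -> ProperFilter (gnbhs g T t).
Proof.
by move=> tT; apply: Build_ProperFilter_ex => P /(gnbhs_ex tT)[s [_ _ Ps]]; exists s.
Qed.

Lemma gderive_base f t : t \in `[0, T] -> gderive g T f t = gderive g T f (gbase g t).
Proof. by move=> tT; rewrite /gderive gnbhs_base// /gquotient gbase_idem. Qed.

Lemma derivator_cvg t : ~ Dg g t -> g x @[x --> t] --> g t.
Proof.
move=> tD; apply/left_right_continuousP; split.
  exact: derivator_left_continuous.
by have := @derivator_cvg_right _ g t; rewrite jump_eq0// addr0.
Qed.

Lemma derivator_cvg_gnbhs t : t \in `[0, T] ->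
  g s @[s --> gnbhs g T t] --> g (gbase g t) + jump g (gbase g t).
Proof.
move=> tT; apply: (@cvg_trans _ (g s @[s -->
    if t \in Cg g `|` Dg g then (gbase g t)^'+ else nbhs t])).
  by apply: cvg_app; rewrite /gnbhs; case: ifP => _; exact: cvg_within.
case: ifPn => tCD; first exact: derivator_cvg_right.
have tC : ~ Cg g t by move=> tC; move/negP: tCD; apply; apply: mem_set; left.
have tD : ~ Dg g t by move=> tD; move/negP: tCD; apply; apply: mem_set; right.
by rewrite gbase_id// jump_eq0// addr0; exact: derivator_cvg.
Qed.

(** Differentiability gives the limit of [w] itself, namely its value plus the
    derivative times the jump of [g]. At jumps [w] may be discontinuous, which is
    where the extra term in the product rule comes from. *)
Lemma gvalue_cvg w t : t \in `[0, T] -> gdifferentiable g T w t ->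
  w s @[s --> gnbhs g T t] -->
    w (gbase g t) + gderive g T w t * of_real k (jump g (gbase g t)).
Proof.
move=> tT dw.
apply: (@cvg_trans _ ((w (gbase g t) + gquotient g w t s *
    of_real k (g s - g (gbase g t))) @[s --> gnbhs g T t])).
  apply: near_eq_cvg; apply: filterS (gnbhs_support t) => s [_ gs].
  rewrite /gquotient divfK; first by rewrite addrC subrK.
  by rewrite fmorph_eq0 subr_eq0.
apply: cvgD; first exact: cvg_cst.
apply: cvgM; first exact: dw.
apply: cvg_of_real.
rewrite [X in _ --> X](_ : _ = g (gbase g t) + jump g (gbase g t) - g (gbase g t)); last by ring.
by apply: cvgB; [exact: derivator_cvg_gnbhs|exact: cvg_cst].
Qed.

(** Write [tau] for [gbase g t]. The increment of the product is
    [f tau * (w s - w tau) + (f s - f tau) * w s], and only the last factor needs a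
    limit. *)
Lemma gderiveM f w t : t \in `[0, T] ->
    gdifferentiable g T f t -> gdifferentiable g T w t ->
  gdifferentiable g T (f \* w) t /\
  gderive g T (f \* w) t = f (gbase g t) * gderive g T w t + gderive g T f t *
    (w (gbase g t) + gderive g T w t * of_real k (jump g (gbase g t))).
Proof.
move=> tT df dw.
suff fw : gquotient g (f \* w) t s @[s --> gnbhs g T t] -->
    f (gbase g t) * gderive g T w t + gderive g T f t *
    (w (gbase g t) + gderive g T w t * of_real k (jump g (gbase g t))).
  split; first by apply/cvg_ex; eexists; exact: fw.
  have := gnbhs_proper tT => ?; exact: cvg_lim fw.
rewrite [X in X @ _](_ : _ = fun s => f (gbase g t) * gquotient g w t s +
    gquotient g f t s * w s); last first.
  by apply/funext => s; rewrite /gquotient/=; ring.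
apply: cvgD; apply: cvgM; [exact: cvg_cst|exact: dw|exact: df|exact: gvalue_cvg].
Qed.

End gbase_theory.

(** * Closure properties of BD functions *)

Section bounded_discontinuous.
Context {R : realType} {k : scalar_kind}.
Variables (g : derivator R) (T : R).
Hypotheses (T_gt0 : 0 < T) (g0 : ~ Ng_minus g 0)
  (gT : ~ (Ng_plus g `|` Dg g `|` Cg g) T).
Local Notation K := (scalars R k).
Implicit Types f w : R -> K.

Lemma bounded_of_real f : [bounded f t | t in `[0, T]] ->
  exists2 M : R, 0 < M & forall t, t \in `[0, T] -> `|f t| <= of_real k M.
Proof.
move=> [N [NR fN]]; have [r r0 rE] := norm_of_real (k := k) N.
exists (r + 1); first by rewrite ltr_wpDl.
move=> t tT; apply: fN tT; apply: le_lt_trans (real_ler_norm NR) _.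
by rewrite rE of_real_lt ltrDl.
Qed.

Lemma of_real_bounded f (M : R) :
  (forall t, t \in `[0, T] -> `|f t| <= of_real k M) -> [bounded f t | t in `[0, T]].
Proof.
move=> fM; exists `|of_real k M|; split; first exact: normr_real.
move=> x Mx t tT; apply: le_trans (fM t tT) _; apply: le_trans (ltW Mx).
by rewrite of_real_norm of_real_le ler_norm.
Qed.

(** The three continuity conditions of [BD] differ only in the set of points that
    are compared with [t]; with this set as a parameter, each closure property is
    proved once. *)
Definition gcontinuous_along (A : set R) f (t : R) : Prop :=
  forall e : K, 0 < e -> exists2 d : R, 0 < d &
    forall s, s \in `[0, T] -> A s -> `|g s - g t| < d -> `|f s - f t| < e.

Lemma gcontinuous_alongS (A B : set R) f t : A `<=` B ->
  gcontinuous_along B f t -> gcontinuous_along A f t.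
Proof.
move=> AB fB e /fB[d d0 fd]; exists d => // s sT /AB; exact: fd.
Qed.

Lemma gcontinuous_alongT f t : gcontinuous_at g T f t <-> gcontinuous_along setT f t.
Proof.
split=> ft e /ft[d d0 fd]; exists d => // s sT.
  by move=> _; rewrite distrC (distrC (f s)); exact: fd.
by rewrite distrC (distrC (f t)); exact: fd.
Qed.

Lemma gcontinuous_along_lt f t :
  left_gcontinuous_at g T f t <-> gcontinuous_along [set s | s < t] f t.
Proof.
split=> ft e /ft[d d0 fd]; exists d => // s sT /= st.
  by rewrite ler0_norm ?subr_le0 ?derivator_le ?ltW// opprB; exact: fd.
by move=> gd; apply: fd => //; rewrite ler0_norm ?subr_le0 ?derivator_le ?ltW// opprB.
Qed.

Lemma gcontinuous_along_gt f t :
  right_gcontinuous_at g T f t <-> gcontinuous_along [set s | t < s] f t.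
Proof.
split=> ft e /ft[d d0 fd]; exists d => // s sT /= st.
  by rewrite ger0_norm ?subr_ge0 ?derivator_le ?ltW//; exact: fd.
by move=> gd; apply: fd => //; rewrite ger0_norm ?subr_ge0 ?derivator_le ?ltW.
Qed.

(** The sets along which a function in [BD] has to be continuous at [t]. *)
Definition gside (t : R) (A : set R) : Prop :=
  [\/ ~ (Cg g `|` Ng g `|` Dg g) t /\ A = setT,
      Ng_minus g t /\ A = [set s | s < t] |
      Ng_plus g t /\ A = [set s | t < s]].

Lemma BDP f : BD g T f <-> [bounded f t | t in `[0, T]] /\
  forall t A, t \in `[0, T] -> gside t A -> gcontinuous_along A f t.
Proof.
split=> [[fb fc fl fr]|[fb fA]].
  split=> // t A tT [] [tA ->]; [apply/gcontinuous_alongT|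
    apply/gcontinuous_along_lt|apply/gcontinuous_along_gt].
  - exact: fc.
  - exact: fl.
  - exact: fr.
split=> // t tT tA; [apply/gcontinuous_alongT|
    apply/gcontinuous_along_lt|apply/gcontinuous_along_gt]; apply: fA => //.
- by apply: Or31.
- by apply: Or32.
- by apply: Or33.
Qed.

Lemma gcontinuous_alongM A f w t : t \in `[0, T] ->
  [bounded f t | t in `[0, T]] -> [bounded w t | t in `[0, T]] ->
  gcontinuous_along A f t -> gcontinuous_along A w t ->
  gcontinuous_along A (f \* w) t.
Proof.
move=> tT /bounded_of_real[M M0 fM] /bounded_of_real[N N0 wN] fA wA e e0.
have MK : 0 < of_real k M by rewrite -(rmorph0 (of_real k)) of_real_lt.
have NK : 0 < of_real k N by rewrite -(rmorph0 (of_real k)) of_real_lt.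
have [d d0 fd] := fA (e / 2 / of_real k N) ltac:(by rewrite !divr_gt0).
have [d' d'0 wd] := wA (e / 2 / of_real k M) ltac:(by rewrite !divr_gt0).
exists (Num.min d d'); first by rewrite lt_min d0.
move=> s sT As; rewrite lt_min => /andP[sd sd'].
rewrite (_ : _ - _ = f s * (w s - w t) + (f s - f t) * w t); last by rewrite /=; ring.
apply: le_lt_trans (ler_normD _ _) _; rewrite !normrM [ltRHS]splitr.
apply: ler_ltD.
  rewrite -[leRHS](divfK (lt0r_neq0 MK)) mulrC; apply: ler_pM => //; first exact: ltW (wd _ _ _ _).
  exact: fM.
apply: le_lt_trans (ler_wpM2l (normr_ge0 _) (wN t tT)) _.
by rewrite -ltr_pdivlMr//; exact: fd.
Qed.

Lemma gcontinuous_alongB A f w t :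
  gcontinuous_along A f t -> gcontinuous_along A w t ->
  gcontinuous_along A (fun s => f s - w s) t.
Proof.
move=> fA wA e e0.
have [d d0 fd] := fA (e / 2) ltac:(by rewrite divr_gt0).
have [d' d'0 wd] := wA (e / 2) ltac:(by rewrite divr_gt0).
exists (Num.min d d'); first by rewrite lt_min d0.
move=> s sT As; rewrite lt_min => /andP[sd sd'].
rewrite (_ : _ - _ = (f s - f t) - (w s - w t)); last by ring.
apply: le_lt_trans (ler_normB _ _) _; rewrite [ltRHS]splitr.
by apply: ltrD; [exact: fd|exact: wd].
Qed.

Lemma boundedM_itv f w : [bounded f t | t in `[0, T]] ->
  [bounded w t | t in `[0, T]] -> [bounded (f \* w) t | t in `[0, T]].
Proof.
move=> /bounded_of_real[M M0 fM] /bounded_of_real[N N0 wN].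
apply: (@of_real_bounded _ (M * N)) => t tT /=.
by rewrite normrM rmorphM ler_pM// ?fM ?wN.
Qed.

Lemma BDM f w : BD g T f -> BD g T w -> BD g T (f \* w).
Proof.
move=> /BDP[fb fA] /BDP[wb wA]; apply/BDP; split; first exact: boundedM_itv.
by move=> t A tT tA; apply: gcontinuous_alongM => //; [exact: fA|exact: wA].
Qed.

Lemma BC_BD f : BC g T f -> BD g T f.
Proof.
move=> [fb fc]; apply/BDP; split=> // t A tT _.
by apply: (@gcontinuous_alongS _ setT) => //; apply/gcontinuous_alongT; exact: fc.
Qed.

Lemma eq_BD f w : (forall t, t \in `[0, T] -> f t = w t) -> BD g T f -> BD g T w.
Proof.
move=> fw /BDP[/bounded_of_real[M M0 fM] fA]; apply/BDP; split.
  by apply: (@of_real_bounded _ M) => t tT; rewrite -fw// fM.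
move=> t A tT tA e e0; have [d d0 fd] := fA t A tT tA e e0.
by exists d => // s sT; rewrite -!fw//; exact: fd.
Qed.

(** Moving [s] to the end of its component does not change [g s], and never
    crosses a point [t] outside [Cg]: the points compared with [t] stay on the same
    side of it or are sent to [t] itself. *)
Lemma BD_gbase f : BD g T f -> BD g T (f \o gbase g).
Proof.
move=> /BDP[/bounded_of_real[M M0 fM] fA]; apply/BDP; split.
  apply: (@of_real_bounded _ M) => t tT; apply: fM.
  by have [_ + _ _ _] := gbase_spec gT tT.
move=> t A tT tA e e0; have [d d0 fd] := fA t A tT tA e e0.
exists d => // s sT As gst.
have tC : ~ Cg g t.
  case: tA => -[tN _].
  - by move=> tC; apply: tN; left; left.
  - exact: Ng_minus_notin_Cg.
  - exact: Ng_plus_notin_Cg.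
have [sb bT _ _ bmin] := gbase_spec gT sT.
rewrite /= (gbase_id tC); have [->|bt] := eqVneq (gbase g s) t.
  by rewrite subrr normr0.
apply: fd => //; last by rewrite (gbase_eq gT).
case: tA As => -[_ ->] //= st; last exact: lt_le_trans sb.
by rewrite lt_neqAle bt bmin// ltW.
Qed.

End bounded_discontinuous.

(** * Mean value inequality *)

Section mean_value.
Context {R : realType} {k : scalar_kind}.
Variables (g : derivator R) (T : R).
Local Notation K := (scalars R k).
Implicit Types f w : R -> K.

Lemma gcontinuous_eq f s t : gcontinuous_at g T f t -> s \in `[0, T] ->
  g s = g t -> f s = f t.
Proof.
move=> ft sT gst; apply/eqP; rewrite -subr_eq0; apply/eqP/norm_lt_all_eq0 => e /ft.
by move=> [d d0]; rewrite distrC; apply => //; rewrite gst subrr normr0.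
Qed.

(** Points [s] with [g s = g t] are invisible to the derivative; there the
    continuity of [f] makes both sides vanish. *)
Lemma growth_right f (L : K) t : t \in `[0, T[ ->
    gcontinuous_at g T f t -> gdifferentiable g T f t ->
    (~ Cg g t -> `|gderive g T f t| < L) -> 
  \forall s \near t^'+, `|f s - f t| <= L * of_real k (g s - g t).
Proof.
rewrite in_itv/= => /andP[t0 tT] fc fd fL.
have itv s : t < s -> s < T -> s \in `[0, T] by move=> *; rewrite in_itv/=; lra.
have [tC|tC] := pselect (Cg g t).
  have [e e0 ge] := tC; near=> s.
  have ts : t < s by near: s; exact: nbhs_right_gt.
  have gs : g s = g t.
    apply: ge; rewrite in_itv/=; last lra.
    apply/andP; split; first lra.
    by near: s; apply: nbhs_right_lt; rewrite ltrDl.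
  rewrite gs (gcontinuous_eq fc _ gs) ?subrr ?normr0 ?rmorph0 ?mulr0//.
  by apply: itv => //; near: s; exact: nbhs_right_lt.
have {}fL := fL tC.
have : gnbhs g T t [set s | `|gquotient g f t s| < L].
  have /cvgrPdist_lt/(_ (L - `|gderive g T f t|)) := fd.
  rewrite subr_gt0 => /(_ fL); apply: filterS => s /= sL.
  rewrite -[gquotient _ _ _ _](subrK (gderive g T f t)).
  apply: le_lt_trans (ler_normD _ _) _; rewrite -ltrBrDr distrC; exact: sL.
move=> /gnbhs_right; rewrite gbase_id// => tL; near=> s.
have ts : t < s by near: s; exact: nbhs_right_gt.
have sT : s \in `[0, T] by apply: itv => //; near: s; exact: nbhs_right_lt.
have [gs|gs] := eqVneq (g s) (g t).
  by rewrite gs (gcontinuous_eq fc _ gs) ?subrr ?normr0 ?rmorph0 ?mulr0.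
have : `|gquotient g f t s| < L by move: sT gs; near: s.
have gts : 0 < g s - g t by rewrite subr_gt0 lt_neqAle eq_sym gs derivator_le// ltW.
rewrite /gquotient gbase_id// normrM normfV of_real_norm (gtr0_norm gts).
by rewrite ltr_pdivrMr; [exact: ltW|rewrite -(rmorph0 (of_real k)) of_real_lt].
Unshelve. all: by end_near. Qed.

(** Continuous induction: the points up to which the bound holds form an interval
    from [c]. It contains its supremum because [f] and [g] are left-continuous, and
    [growth_right] pushes it further to the right. *)
Lemma gmean_value_strict f (L : K) c d : 0 <= c -> c <= d -> d <= T ->
    (forall t, t \in `[0, T] -> gcontinuous_at g T f t) ->
    (forall t, c <= t -> t < d -> gdifferentiable g T f t) ->
    (forall t, c <= t -> t < d -> ~ Cg g t -> `|gderive g T f t| < L) -> 0 <= L ->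
  `|f d - f c| <= L * of_real k (g d - g c).
Proof.
move=> c0 cd dT fc fd fL L0.
pose P s := `|f s - f c| <= L * of_real k (g s - g c).
pose E := [set t | c <= t <= d /\ forall s, c <= s -> s <= t -> P s].
have Pc : P c by rewrite /P !subrr normr0 rmorph0 mulr0.
have Ec : E c by split=> [|s cs sc]; [rewrite lexx|have -> : s = c by apply/eqP; rewrite eq_le sc].
have hE : has_sup E by split; [exists c|exists d => t [/andP[]]].
set b := sup E.
have cb : c <= b by apply: ub_le_sup => //; case: hE.
have bd : b <= d by apply: ge_sup; [exists c|move=> t [/andP[]]].
have bT : b \in `[0, T] by rewrite in_itv/=; lra.
have Pbelow s : c <= s -> s < b -> P s.
  move=> cs sb; have [x [_ xP] sx] := sup_adherent (eps := b - s) ltac:(by rewrite subr_gt0) hE.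
  by apply: xP => //; apply: ltW; move: sx; rewrite opprB addrC subrK.
have Pb : P b.
  have [->//|cNb] := eqVneq b c.
  apply/ler_addgt0Pr => e /(fc b bT)[r r0 fr].
  have [x xb gx] := derivator_left_close g b r0.
  pose s := Num.max x c.
  have sb : s < b by rewrite gt_max xb lt_neqAle eq_sym cNb.
  have cs : c <= s by rewrite le_max lexx orbT.
  have xs : x <= s by rewrite le_max lexx.
  have sT : s \in `[0, T] by rewrite in_itv/=; lra.
  have gsb : `|g b - g s| < r.
    rewrite ger0_norm ?subr_ge0 ?derivator_le ?ltW//.
    by have := derivator_le g xs; lra.
  have -> : f b - f c = (f s - f c) + (f b - f s) by ring.
  apply: le_trans (ler_normD _ _) _; apply: lerD; last exact/ltW/fr.
  apply: le_trans (Pbelow s cs sb) _; apply: ler_wpM2l => //.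
  by rewrite of_real_le lerB// derivator_le ?ltW.
have Ple s : c <= s -> s <= b -> P s.
  by move=> cs; rewrite le_eqVlt => /orP[/eqP->//|]; exact: Pbelow.
have [<-//|bNd] := eqVneq b d.
have bltd : b < d by rewrite lt_neqAle bNd.
have bT' : b \in `[0, T[ by rewrite in_itv/=; lra.
have := growth_right bT' (fc b bT) (fd b cb bltd) (fL b cb bltd).
case=> e /= e0 be; pose y := Num.min (b + e / 2) d.
have [ye yd] : y <= b + e / 2 /\ y <= d by rewrite !ge_min !lexx orbT.
have by_ : b < y by rewrite lt_min bltd andbT; lra.
suff : y <= b by rewrite leNgt by_.
apply: ub_le_sup; first by case: hE.
split=> [|s cs sy]; first lra.
have [sb|bs] := leP s b; first exact: Ple.
rewrite /P; have -> : f s - f c = (f s - f b) + (f b - f c) by ring.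
rewrite [g s - g c](_ : _ = (g s - g b) + (g b - g c)); last by ring.
rewrite rmorphD mulrDr; apply: le_trans (ler_normD _ _) _; apply: lerD => //.
apply: be => //=; rewrite ltr0_norm; lra.
Qed.

Lemma gmean_value f (L : K) c d : 0 <= c -> c <= d -> d <= T ->
    (forall t, t \in `[0, T] -> gcontinuous_at g T f t) ->
    (forall t, c <= t -> t < d -> gdifferentiable g T f t) ->
    (forall t, c <= t -> t < d -> ~ Cg g t -> `|gderive g T f t| <= L) -> 0 <= L ->
  `|f d - f c| <= L * of_real k (g d - g c).
Proof.
move=> c0 cd dT fc fd fL L0; apply/ler_addgt0Pr => e e0.
have gcd : 0 <= of_real k (g d - g c).
  by rewrite -(rmorph0 (of_real k)) of_real_le subr_ge0 derivator_le.
have gcd1 : 0 < of_real k (g d - g c) + 1 by rewrite ltr_wpDl.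
pose eta := e / (of_real k (g d - g c) + 1).
have eta0 : 0 < eta by rewrite divr_gt0.
apply: le_trans (@gmean_value_strict f (L + eta) c d c0 cd dT fc fd _ _) _.
- by move=> t ct td tC; apply: le_lt_trans (fL t ct td tC) _; rewrite ltrDl.
- by rewrite addr_ge0// ltW.
- rewrite mulrDl lerD2l /eta mulrAC ler_pdivrMr//.
  by rewrite mulrDr mulr1 lerDl ltW.
Qed.

End mean_value.

(** * From almost everywhere to everywhere, and zeros of solutions *)

(** The half-open interval from [t] to [t + 1/n] has measure at least [jump g t],
    and these intervals decrease to the singleton. *)
Lemma gmeasure_set1_ge (R : realType) (g : derivator R) t :
  ((jump g t)%:E <= gmeasure g [set t])%E.
Proof.
pose F n : set (measurableTypeR R) := `[t, t + n.+1%:R^-1[%classic.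
have FE n : gmeasure g (F n) = (g (t + n.+1%:R^-1) - g t)%:E.
  by rewrite gmeasure_itvco// lerDl.
have capF : \bigcap_n F n = [set t].
  apply/seteqP; split=> [x Fx|_ -> n _] /=; last by rewrite /F/= in_itv/= lexx ltrDl invr_gt0 ltr0n.
  apply/eqP; rewrite eq_le; apply/andP; split; last first.
    by have := Fx 0%N I; rewrite /F/= in_itv/= => /andP[].
  apply/ler_addgt0Pr => e e0.
  have [n _ /(_ n (leqnn _)) ne] := near_infty_natSinv_lt (PosNum e0).
  have := Fx n I; rewrite /F/= in_itv/= => /andP[_ xt].
  by apply/ltW/(lt_trans xt); rewrite ltrD2l.
have mcap : measurable (\bigcap_n F n) by rewrite capF; exact: measurable_set1.
have mF n : measurable (F n) by exact: measurable_itv.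
have Fcvg : (gmeasure g \o F) x @[x --> \oo] --> gmeasure g (\bigcap_n F n).
  apply: nonincreasing_cvg_mu => //.
  - by rewrite [X in (X < _)%E]FE ltry.
  - move=> m n mn; apply/subsetPset => x; rewrite /F/= !in_itv/= => /andP[-> xt]/=.
    by apply: lt_le_trans xt _; rewrite lerD2l lef_pV2 ?posrE// ler_nat.
rewrite -[X in gmeasure g X]capF; apply: cvge_ge Fcvg; apply: nearW => n /=; rewrite FE lee_fin.
by rewrite lerBrDl; apply: derivator_ge_jump; rewrite ltrDl invr_gt0 ltr0n.
Qed.

Section equation.
Context {R : realType} {k : scalar_kind}.
Variables (g : derivator R) (T : R).
Hypotheses (T_gt0 : 0 < T) (g0 : ~ Ng_minus g 0)
  (gT : ~ (Ng_plus g `|` Dg g `|` Cg g) T).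
Local Notation K := (scalars R k).
Implicit Types f w : R -> K.

Lemma ae_itv_ex (P : R -> Prop) x y :
  {ae gmeasure g, forall t : R, P t} -> g x < g y ->
  exists t, [/\ x <= t, t < y & P t].
Proof.
move=> [A [mA A0 PA]] gxy; apply: contrapT => noP.
have xy : x <= y.
  by rewrite leNgt; apply/negP => /ltW/(derivator_le g); rewrite leNgt gxy.
have : (gmeasure g `[x, y[ <= gmeasure g A)%E.
  apply: le_measure; rewrite ?inE// => t /=; rewrite in_itv/= => /andP[xt ty].
  by apply: PA => Pt; apply: noP; exists t.
by rewrite A0 gmeasure_itvco// lee_fin subr_le0 leNgt gxy.
Qed.

Lemma ae_jump (P : R -> Prop) t :
  {ae gmeasure g, forall t : R, P t} -> Dg g t -> P t.
Proof.
move=> [A [mA A0 PA]] tD; apply: contrapT => nPt.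
have : (gmeasure g [set t] <= gmeasure g A)%E.
  by apply: le_measure; rewrite ?inE// => _ ->; exact: PA.
rewrite A0 => /(le_trans (gmeasure_set1_ge g t)); rewrite lee_fin leNgt.
by move/negP; apply.
Qed.

Lemma BD_left_continuous f t : BD g T f -> t \in `[0, T] ->
  ~ Cg g t -> ~ Dg g t -> Ng_minus g t \/ ~ Ng g t ->
  gcontinuous_along g T [set s | s < t] f t.
Proof.
move=> /BDP[_ fA] tT tC tD [tN|tN]; first by apply: fA => //; apply: Or32.
apply: (@gcontinuous_alongS _ _ _ _ _ setT) => //.
by apply: fA => //; apply: Or31; split => // -[[]|].
Qed.

Lemma BD_right_continuous f t : BD g T f -> t \in `[0, T] ->
  ~ Cg g t -> ~ Dg g t -> Ng_plus g t \/ ~ Ng g t ->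
  gcontinuous_along g T [set s | t < s] f t.
Proof.
move=> /BDP[_ fA] tT tC tD [tN|tN]; first by apply: fA => //; apply: Or33.
apply: (@gcontinuous_alongS _ _ _ _ _ setT) => //.
by apply: fA => //; apply: Or31; split => // -[[]|].
Qed.

(** Jumps are atoms. At another point outside [Cg], [accumulation_cases] gives a
    side on which [f] and [w] are g-continuous and on which every interval reaching
    [t] has positive measure, hence contains a point where [f] and [w] agree. *)
Lemma BD_ae_eq f w : BD g T f -> BD g T w ->
    {ae gmeasure g, forall t : R, t \in `[0, T[ -> f t = w t} ->
  forall t, t \in `[0, T] -> ~ Cg g t -> f t = w t.
Proof.
move=> fBD wBD fw t tT tC.
have [tD|tD] := pselect (Dg g t).
  apply: (ae_jump fw tD); move: tT; rewrite !in_itv/= => /andP[-> tT] /=.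
  by rewrite lt_neqAle tT andbT; apply/eqP => tE; apply: (T_notin_Dg gT); rewrite -tE.
apply/eqP; rewrite -subr_eq0; apply/eqP/norm_lt_all_eq0 => e e0.
have [[t0 _ tN lt]|[tltT tN gt]] := accumulation_cases T_gt0 g0 gT tT tC.
- have [d d0 fwd] := gcontinuous_alongB (BD_left_continuous fBD tT tC tD tN)
    (BD_left_continuous wBD tT tC tD tN) e0.
  have [x xt gx] := derivator_left_close g t d0.
  have [s [xs st fws]] : exists s, [/\ Num.max x 0 <= s, s < t &
      s \in `[0, T[ -> f s = w s].
    by apply: (ae_itv_ex fw); apply: lt; rewrite gt_max xt t0.
  move: xs tT; rewrite ge_max in_itv/= => /andP[xs s0] /andP[_ tT].
  have gst : `|g s - g t| < d.
    rewrite ler0_norm ?subr_le0 ?derivator_le ?ltW// opprB.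
    by have := derivator_le g xs; lra.
  have := fwd s _ st gst; rewrite fws ?in_itv/=; last lra.
  by rewrite subrr sub0r normrN; apply; lra.
- have [d d0 fwd] := gcontinuous_alongB (BD_right_continuous fBD tT tC tD tN)
    (BD_right_continuous wBD tT tC tD tN) e0.
  have [x tx gx] := derivator_right_close tD d0.
  have [s [ts sx fws]] : exists s, [/\ t <= s, s < Num.min x T &
      s \in `[0, T[ -> f s = w s].
    by apply: (ae_itv_ex fw); apply: gt; rewrite lt_min tx tltT.
  move: sx tT; rewrite lt_min in_itv/= => /andP[sx sT] /andP[t0 _].
  have {}fws : f s = w s by apply: fws; rewrite in_itv/=; lra.
  have [ts'|st|st] := ltgtP t s; last by rewrite st fws subrr normr0.
    have gst : `|g s - g t| < d.
      rewrite ger0_norm ?subr_ge0 ?derivator_le//.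
      by have := derivator_le g (ltW sx); lra.
    have := fwd s _ ts' gst; rewrite fws subrr sub0r normrN in_itv/=.
    by apply; lra.
  by move: ts; rewrite leNgt st.
Qed.

Variables (beta v : R -> K).
Hypotheses (beta_bnd : [bounded beta t | t in `[0, T]])
  (beta_reg : gregressive g T beta)
  (v_bnd : [bounded v t | t in `[0, T]])
  (v_cont : forall t, t \in `[0, T] -> gcontinuous_at g T v t)
  (v_diff : forall t, t \in `[0, T] -> gdifferentiable g T v t)
  (v_eq : forall t, t \in `[0, T] -> ~ Cg g t -> gderive g T v t = beta t * v t)
  (v0 : v 0 = 1).

Lemma jump_factor_neq0 t : t \in `[0, T] -> 1 + beta t * of_real k (jump g t) != 0.
Proof.
move=> tT; have [tD|tD] := pselect (Dg g t); first exact: beta_reg.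
by rewrite jump_eq0// rmorph0 mulr0 addr0 oner_neq0.
Qed.

(** Gronwall argument run backwards from [t]. Let [M] bound [beta] and let [A] be
    the supremum of [`|v|] over [[c, t]]. The mean value inequality bounds [`|v s|]
    by [M * A * (g t - g s)]; left-continuity of [g] at [t] lets [c] be chosen so
    that this is at most [A / 2], and then [A = 0]. *)
Lemma zero_spreads_left t : t \in `[0, T] -> 0 < t -> v t = 0 ->
  exists2 c, c < t & c \in `[0, T] /\ v c = 0.
Proof.
rewrite in_itv/= => /andP[_ tT] t0 vt.
have [M M0 bM] := bounded_of_real beta_bnd.
have [N N0 vN] := bounded_of_real v_bnd.
have [x xt gx] : exists2 c, c < t & g t - g c < (2 * M)^-1.
  by apply: derivator_left_close; rewrite invr_gt0 mulr_gt0.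
pose c := Num.max x 0; have ct : c < t by rewrite gt_max xt.
have c0 : 0 <= c by rewrite le_max lexx orbT.
have gc : g t - g c < (2 * M)^-1.
  by apply: le_lt_trans gx; rewrite lerB// derivator_le// le_max lexx.
exists c => //; split; first by rewrite in_itv/=; lra.
pose S := [set r | exists2 s, c <= s <= t & `|v s| = of_real k r].
have cS : exists r, S r.
  by have [r _ rE] := norm_of_real (v c); exists r; exists c => //; rewrite lexx ltW.
have hS : has_sup S.
  split => //; exists N => r [s /andP[cs st] sr].
  by rewrite -(@of_real_le R k) -sr; apply: vN; rewrite in_itv/=; lra.
pose A := sup S.
have vA s : c <= s -> s <= t -> `|v s| <= of_real k A.
  move=> cs st; have [r _ rE] := norm_of_real (v s).
  rewrite rE of_real_le; apply: ub_le_sup; first by case: hS.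
  by exists s; rewrite // cs st.
have A0 : 0 <= A.
  by rewrite -(@of_real_le R k) rmorph0; apply: le_trans (vA c (lexx _) (ltW ct)).
have half s : c <= s -> s <= t -> `|v s| <= of_real k (A / 2).
  move=> cs st.
  have : `|v t - v s| <= of_real k (M * A) * of_real k (g t - g s).
    apply: (gmean_value (T := T)) => //.
    - lra.
    - by move=> u su ut; apply: v_diff; rewrite in_itv/=; lra.
    - move=> u su ut uC; have uT : u \in `[0, T] by rewrite in_itv/=; lra.
      by rewrite v_eq// normrM rmorphM ler_pM ?bM// vA//; lra.
    - by rewrite -(rmorph0 (of_real k)) of_real_le mulr_ge0// ltW.
  rewrite vt sub0r normrN => /le_trans; apply; rewrite -rmorphM of_real_le.
  rewrite mulrAC mulrC ler_wpM2l//.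
  have gst : g t - g s <= (2 * M)^-1 by have := derivator_le g cs; lra.
  apply: le_trans (ler_wpM2l (ltW M0) gst) _.
  by rewrite invfM mulrCA divff ?mulr1// gt_eqF.
have AA : A <= A / 2.
  apply: ge_sup => // r [s /andP[cs st] sr].
  by rewrite -(@of_real_le R k) -sr half.
have /eqP AE : A == 0 by rewrite eq_le A0 andbT; lra.
apply/eqP; rewrite -normr_le0.
by apply: le_trans (vA c (lexx _) (ltW ct)) _; rewrite AE rmorph0.
Qed.

(** At a jump [b], [v] tends from the right to
    [v b * (1 + beta b * jump g b)]. When zeros of [v] decrease to [b], this limit
    vanishes, so [v b = 0] because [beta] is regressive. *)
Lemma zeros_inf (Z := [set t | t \in `[0, T] /\ v t = 0]) : Z !=set0 -> Z (inf Z).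
Proof.
move=> Z0; have hZ : has_inf Z.
  by split => //; exists 0 => t [+ _]; rewrite in_itv/= => /andP[].
set b := inf Z.
have lbZ t : Z t -> b <= t by move=> Zt; apply: ge_inf => //; case: hZ.
have bT : b \in `[0, T].
  rewrite in_itv/=; apply/andP; split.
    by apply: lb_le_inf => // t [+ _]; rewrite in_itv/= => /andP[].
  by have [t Zt] := Z0; apply: le_trans (lbZ t Zt) _; have [+ _] := Zt; rewrite in_itv/= => /andP[].
split => //.
have [[s [[sT vs] gs]]|noflat] := pselect (exists s, Z s /\ g s = g b).
  by rewrite -(gcontinuous_eq (v_cont bT) sT gs).
have approach (e : R) : 0 < e -> exists s, [/\ Z s, b < s, s < b + e & g s != g b].
  move=> e0; have [s Zs sb] := inf_adherent e0 hZ.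
  have gs : g s != g b by apply/eqP => gs; apply: noflat; exists s.
  exists s; split => //; rewrite lt_neqAle lbZ// andbT.
  by apply: contra gs => /eqP ->.
have bC : ~ Cg g b.
  move=> [e e0 ge]; have [s [_ bs se]] := approach e e0.
  by rewrite (ge s b) ?eqxx// in_itv/=; lra.
have vlim := gvalue_cvg bT (v_diff bT).
rewrite gbase_id// v_eq// in vlim.
rewrite (_ : _ + _ = v b * (1 + beta b * of_real k (jump g b))) in vlim; last by ring.
have bP := gnbhs_proper T_gt0 g0 gT bT.
have bj := jump_factor_neq0 bT.
apply/eqP; apply: contraT => vb.
have lim0 : v b * (1 + beta b * of_real k (jump g b)) != 0 by rewrite mulf_neq0.
have /gnbhs_right : gnbhs g T b [set s | v s != 0].
  exact: cvgr_neq0 vlim lim0.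
rewrite gbase_id// => -[e /= e0 be].
have [s [[sT vs] bs se gs]] := approach e e0.
have := be s _ bs sT gs; rewrite vs eqxx; apply.
by rewrite /= ltr0_norm; lra.
Qed.

(** A first zero would be positive, since [v 0 = 1], and preceded by another one. *)
Lemma solution_neq0 t : t \in `[0, T] -> v t != 0.
Proof.
move=> tT; apply/eqP => vt.
pose Z := [set t | t \in `[0, T] /\ v t = 0].
have [bT vb] : Z (inf Z) by apply: zeros_inf; exists t.
have b0 : 0 < inf Z.
  move: bT; rewrite in_itv/= lt_neqAle => /andP[-> _]; rewrite andbT.
  by apply/eqP => b0; move: vb; rewrite -b0 v0 => /eqP; rewrite oner_eq0.
have [c cb Zc] := zero_spreads_left bT b0 vb.
have : inf Z <= c.
  by apply: ge_inf => //; exists 0 => s [+ _]; rewrite in_itv/= => /andP[].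
by rewrite leNgt cb.
Qed.

End equation.

(** * Kernel of the g-derivative and solutions *)

Theorem proposition5p4 (R : realType) (k : scalar_kind) (T : R) (T_gt0 : 0 < T)
    (g : derivator R)
    (g0 : ~ Ng_minus g 0) (gT : ~ (Ng_plus g `|` Dg g `|` Cg g) T)
    (beta : R -> scalars R k)
    (beta_BD : BD g T beta) (beta_reg : gregressive g T beta)
    (v : R -> scalars R k)
    (v_W11 : W11 g T v) (v_BC1 : BC1 g T v) (v_sol : solves_P g T beta v)
    (h : R -> scalars R k) (h_BD1 : BD1 g T h) (h0 : h 0 = 1) :
  ker_gderive g T h <->
  [/\ BD1 g T (h \* v), solves_P g T beta (h \* v) &
      forall t, t \in `[0, T] -> ~ Cg g t ->
        gderive g T (h \* v) t - beta t * (h \* v) t = 0].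
Proof.
have [v_BC v_diff v'_BC] := v_BC1; have [h_BD h_diff h'_BD] := h_BD1.
have [v_bnd v_cont] := v_BC; have [beta_bnd _ _ _] := beta_BD.
have [v_ae v0] := v_sol.
have v_eq : forall t, t \in `[0, T] -> ~ Cg g t -> gderive g T v t = beta t * v t.
  apply: (BD_ae_eq T_gt0 g0 gT (BC_BD v'_BC) (BDM beta_BD (BC_BD v_BC))).
  apply: negligibleS v_ae => t /= nP vt; apply: nP => /vt[_ /eqP].
  by rewrite subr_eq0 => /eqP.
have leibniz t (tT : t \in `[0, T]) :=
  gderiveM T_gt0 g0 gT tT (h_diff t tT) (v_diff t tT).
split=> [[_ h'0]|[_ _ hv_eq]].
  have hv' t : t \in `[0, T] ->
      gderive g T (h \* v) t = h (gbase g t) * gderive g T v t.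
    by move=> tT; have [_ ->] := leibniz t tT; rewrite h'0// mul0r addr0.
  have hv_eq t : t \in `[0, T] -> ~ Cg g t ->
      gderive g T (h \* v) t - beta t * (h \* v) t = 0.
    by move=> tT tC; rewrite hv'// gbase_id// v_eq//=; ring.
  have hv_diff t : t \in `[0, T] -> gdifferentiable g T (h \* v) t.
    by move=> tT; have [] := leibniz t tT.
  split => //.
  - split; [exact: BDM h_BD (BC_BD v_BC)|exact: hv_diff|].
    (* On a component of [Cg], the derivative of the product involves the value
       of [h] at the right endpoint, not at [t]. *)
    apply: (eq_BD (f := (h \o gbase g) \* gderive g T v)); first by move=> t /hv' ->.
    by apply: BDM; [exact: BD_gbase|exact: BC_BD].
  - split; last by rewrite /= h0 v0 mulr1.
    apply: negligibleS (negligible_Cg g) => t /= hvt; apply: contrapT => tC.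
    apply: hvt => tT; have {}tT : t \in `[0, T].
      by move: tT; rewrite !in_itv/= => /andP[-> /ltW].
    by split; [exact: hv_diff|exact: hv_eq].
have h'0 t : t \in `[0, T] -> ~ Cg g t -> gderive g T h t = 0.
  move=> tT tC; have := hv_eq t tT tC; have [_ ->] := leibniz t tT.
  rewrite gbase_id// v_eq// => /eqP.
  rewrite (_ : _ - _ = gderive g T h t * (v t *
    (1 + beta t * of_real k (jump g t)))); last by rewrite /=; ring.
  rewrite !mulf_eq0 (negbTE (jump_factor_neq0 beta_reg tT)).
  by rewrite (negbTE (solution_neq0 T_gt0 g0 gT _ beta_reg _ v_cont v_diff v_eq v0 tT))// !orbF => /eqP.
split => // t tT; rewrite (gderive_base gT h tT).
by have [_ bT bC _ _] := gbase_spec gT tT; exact: h'0.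
Qed.
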